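(* Let $G$ be a linear group such that $G$ is finitely generated or $G=G'$. Then $G\bowtie G$ is linear.
   Context: A group is called linear if, for some positive integer $n$ and some field $P$, it is isomorphic to a subgroup of $GL_n(P)$. $G'$ is the derived subgroup of $G$. Given groups $G$ and $H$ acting compatibly on each other (on the right, $(g,h)\mapsto g^h$, $(h,g)\mapsto h^g$), the Peiffer product $G\bowtie H$ is the quotient of the free product $G*H$ by the normal closure of all elements of the form $h^{-1}g^{-1}hg^h$ and $g^{-1}h^{-1}gh^g$, where $g\in G$, $h\in H$. The Peiffer square $G\bowtie G$ is the Peiffer product of two copies of $G$, with each copy acting on the other by conjugation, $x^y=y^{-1}xy$. *)

(* Defs.v *)
From HB Require Import structures.
From mathcomp Require Import all_boot all_algebra.
From mathcomp Require Import boolp classical_sets.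

Set Implicit Arguments.
Unset Strict Implicit.
Unset Printing Implicit Defensive.

Local Open Scope classical_set_scope.
Local Open Scope group_scope.
Local Open Scope quotient_scope.

(* Groups are arbitrary, possibly infinite, [groupType]s; as in the library,
   x ^ y is y^-1 * (x * y) and [~ x, y] is x^-1 * (y^-1 * (x * y)). *)

Definition is_subgroup (G : groupType) (S : set G) : Prop :=
  S 1 /\ forall x y, S x -> S y -> S (x / y).

Definition is_normal_subgroup (G : groupType) (S : set G) : Prop :=
  is_subgroup S /\ forall x y, S x -> S (x ^ y).

Definition generated (G : groupType) (A : set G) : set G :=
  smallest (@is_subgroup G) A.

Definition normal_closure (G : groupType) (A : set G) : set G :=
  smallest (@is_normal_subgroup G) A.

Definition finitely_generated (G : groupType) : Prop :=
  exists s : seq G, generated [set` s] = setT.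

Definition derived_subgroup (G : groupType) : set G :=
  generated [set z | exists x y : G, z = [~ x, y]].
Arguments derived_subgroup : clear implicits.

(* An isomorphism onto a subgroup of GL_n(P) is the same thing as an injective
   multiplicative map into the n x n matrices with invertible values. *)
Definition linear_group (G : groupType) : Prop :=
  exists (n : nat) (P : fieldType) (f : G -> 'M[P]_n),
    [/\ (0 < n)%N,
        forall x, f x \in unitmx,
        {morph f : x y / x * y >-> (x *m y)%R} &
        injective f].

Section QuotientGroup.
Variables (G : groupType) (N : set G) (nN : is_normal_subgroup N).

Let N1 : N 1. Proof. exact: nN.1.1. Qed.
Let NF x y : N x -> N y -> N (x / y). Proof. exact: nN.1.2. Qed.
Let NJ x y : N x -> N (x ^ y). Proof. exact: nN.2. Qed.
Let NV x : N x -> N x^-1.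
Proof. by move=> Nx; rewrite -[x^-1]mul1g; apply: NF. Qed.
Let NM x y : N x -> N y -> N (x * y).
Proof. by move=> Nx Ny; rewrite -[y]invgK; apply/NF/NV. Qed.

Definition coset_rel (x y : G) : bool := `[< N (x / y) >].

Fact coset_rel_equiv : equiv_class_of coset_rel.
Proof.
split=> [x | x y | y x z].
- by apply/asboolP; rewrite mulgV.
- by apply: asbool_equiv_eq; split=> /NV; rewrite invgF.
- move=> /asboolP Nxy /asboolP Nyz; apply/asboolP.
  by rewrite -(mulgVK y x) -mulgA; apply: NM.
Qed.

Canonical coset_equiv := EquivRelPack coset_rel_equiv.

Definition quotient_group := {eq_quot coset_equiv}.
HB.instance Definition _ := Choice.on quotient_group.
HB.instance Definition _ := EqQuotient.on quotient_group.

Definition quotient_one : quotient_group := \pi_quotient_group 1.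
Definition quotient_mul (x y : quotient_group) : quotient_group :=
  \pi_quotient_group (repr x * repr y).
Definition quotient_inv (x : quotient_group) : quotient_group :=
  \pi_quotient_group (repr x)^-1.

Let piP x y : N (x / y) -> \pi_quotient_group x = \pi_quotient_group y.
Proof. by move=> Nxy; apply/eqmodP/asboolP. Qed.

Let reprP x : N (repr (\pi_quotient_group x) / x).
Proof. by apply/asboolP; rewrite -[asbool _]/(coset_equiv _ _); apply/eqmodP; rewrite reprK. Qed.

Fact quotient_piM x y :
  quotient_mul (\pi_quotient_group x) (\pi_quotient_group y)
    = \pi_quotient_group (x * y).
Proof.
apply: piP; set x' := repr _; set y' := repr _.
have -> : x' * y' / (x * y) = (y' / y) ^ x'^-1 * (x' / x).
  by rewrite /conjg !invgK invgM !mulgA mulgVK.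
by apply: NM; [apply/NJ/reprP | apply: reprP].
Qed.

Fact quotient_piV x :
  quotient_inv (\pi_quotient_group x) = \pi_quotient_group x^-1.
Proof.
apply: piP; rewrite invgK; set x' := repr _.
have -> : x'^-1 * x = ((x' / x)^-1) ^ x'.
  by rewrite invgF /conjg mulgVK.
by apply/NJ/NV/reprP.
Qed.

Fact quotient_mulA : associative quotient_mul.
Proof.
move=> x y z; rewrite -[x]reprK -[y]reprK -[z]reprK.
by rewrite (quotient_piM (repr y)) (quotient_piM (repr x) (repr y)) 2!quotient_piM mulgA.
Qed.
Fact quotient_mul1 : left_id quotient_one quotient_mul.
Proof. by move=> x; rewrite -[x]reprK quotient_piM mul1g. Qed.
Fact quotient_mulr1 : right_id quotient_one quotient_mul.
Proof. by move=> x; rewrite -[x]reprK quotient_piM mulg1. Qed.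
Fact quotient_mulV : left_inverse quotient_one quotient_inv quotient_mul.
Proof. by move=> x; rewrite -[x]reprK quotient_piV quotient_piM mulVg. Qed.
Fact quotient_mulrV : right_inverse quotient_one quotient_inv quotient_mul.
Proof. by move=> x; rewrite -[x]reprK quotient_piV quotient_piM mulgV. Qed.

HB.instance Definition _ := isGroup.Build quotient_group
  quotient_mulA quotient_mul1 quotient_mulr1 quotient_mulV quotient_mulrV.

End QuotientGroup.

Fact normal_closure_normal (G : groupType) (A : set G) :
  is_normal_subgroup (normal_closure A).
Proof.
split; first split.
- by move=> S [[[S1 _] _] _].
- move=> x y Ax Ay S SA; have [[[_ SF] _] _] := SA.
  by apply: SF; [apply: (Ax S SA) | apply: (Ay S SA)].
- by move=> x y Ax S SA; have [[_ SJ] _] := SA; apply: SJ; apply: (Ax S SA).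
Qed.

(* The free product of G and H: words in the letters of G and H, modulo the
   congruence (for concatenation) generated by the multiplication in G and in H. *)
Section FreeProduct.
Variables G H : groupType.

Inductive word_eq : seq (G + H) -> seq (G + H) -> Prop :=
| WordRefl u : word_eq u u
| WordSym u v : word_eq u v -> word_eq v u
| WordTrans u v w : word_eq u v -> word_eq v w -> word_eq u w
| WordCat u u' v v' :
    word_eq u u' -> word_eq v v' -> word_eq (u ++ v) (u' ++ v')
| WordOneL : word_eq [:: inl 1] [::]
| WordOneR : word_eq [:: inr 1] [::]
| WordMulL x y : word_eq [:: inl x; inl y] [:: inl (x * y)]
| WordMulR x y : word_eq [:: inr x; inr y] [:: inr (x * y)].

Definition word_rel u v : bool := `[< word_eq u v >].

Fact word_rel_equiv : equiv_class_of word_rel.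
Proof.
split=> [u | u v | v u w].
- exact/asboolP/WordRefl.
- by apply: asbool_equiv_eq; split; apply: WordSym.
- by move=> /asboolP uv /asboolP vw; apply/asboolP; apply: WordTrans uv vw.
Qed.

Canonical word_equiv := EquivRelPack word_rel_equiv.

Definition free_product := {eq_quot word_equiv}.
HB.instance Definition _ := Choice.on free_product.
HB.instance Definition _ := EqQuotient.on free_product.

Definition letter_inv (a : G + H) : G + H :=
  match a with inl x => inl x^-1 | inr y => inr y^-1 end.
Definition word_inv (u : seq (G + H)) : seq (G + H) := rev (map letter_inv u).

Definition fp_one : free_product := \pi_free_product [::].
Definition fp_mul (x y : free_product) : free_product :=
  \pi_free_product (repr x ++ repr y).
Definition fp_inv (x : free_product) : free_product :=
  \pi_free_product (word_inv (repr x)).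

Let piP u v : word_eq u v -> \pi_free_product u = \pi_free_product v.
Proof. by move=> uv; apply/eqmodP/asboolP. Qed.

Let reprP u : word_eq (repr (\pi_free_product u)) u.
Proof. by apply/asboolP; rewrite -[asbool _]/(word_equiv _ _); apply/eqmodP; rewrite reprK. Qed.

Let letter_invK : involutive letter_inv.
Proof. by case=> x /=; rewrite invgK. Qed.

Let word_invK : involutive word_inv.
Proof.
by move=> u; rewrite /word_inv map_rev revK mapK.
Qed.

Let word_mulrV u : word_eq (u ++ word_inv u) [::].
Proof.
elim: u => [|a u IHu]; first exact: WordRefl.
have -> : (a :: u) ++ word_inv (a :: u)
          = [:: a] ++ ((u ++ word_inv u) ++ [:: letter_inv a]).
  by rewrite /word_inv /= rev_cons -cats1 catA.
apply: (@WordTrans _ ([:: a] ++ [:: letter_inv a])).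
  apply: WordCat; first exact: WordRefl.
  by rewrite -[X in word_eq _ X]cat0s; apply: WordCat IHu (WordRefl _).
case: a => x /=.
  by apply: WordTrans (WordMulL _ _) _; rewrite mulgV; apply: WordOneL.
by apply: WordTrans (WordMulR _ _) _; rewrite mulgV; apply: WordOneR.
Qed.

Let word_mulV u : word_eq (word_inv u ++ u) [::].
Proof. by rewrite -{2}[u]word_invK; apply: word_mulrV. Qed.

Fact fp_piM u v :
  fp_mul (\pi_free_product u) (\pi_free_product v) = \pi_free_product (u ++ v).
Proof. by apply/piP/WordCat; apply: reprP. Qed.

Fact fp_mulA : associative fp_mul.
Proof.
move=> x y z; rewrite -[x]reprK -[y]reprK -[z]reprK.
by rewrite (fp_piM (repr y)) (fp_piM (repr x) (repr y)) 2!fp_piM catA.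
Qed.
Fact fp_mul1 : left_id fp_one fp_mul.
Proof. by move=> x; rewrite -[x]reprK fp_piM. Qed.
Fact fp_mulr1 : right_id fp_one fp_mul.
Proof. by move=> x; rewrite -[x]reprK fp_piM cats0. Qed.
Fact fp_mulV : left_inverse fp_one fp_inv fp_mul.
Proof. by move=> x; rewrite -{2}[x]reprK fp_piM; apply/piP/word_mulV. Qed.
Fact fp_mulrV : right_inverse fp_one fp_inv fp_mul.
Proof. by move=> x; rewrite -{1}[x]reprK fp_piM; apply/piP/word_mulrV. Qed.

HB.instance Definition _ := isGroup.Build free_product
  fp_mulA fp_mul1 fp_mulr1 fp_mulV fp_mulrV.

Definition fp_inl (x : G) : free_product := \pi_free_product [:: inl x].
Definition fp_inr (y : H) : free_product := \pi_free_product [:: inr y].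

End FreeProduct.

(* Right actions by automorphisms of each of G and H on the other: actl g h is
   g^h and actr h g is h^g. The last two fields are compatibility,
   g^(h^g1) = g^(g1^-1 h g1) and h^(g^h1) = h^(h1^-1 g h1), where the exponents
   on the right are words in G and H, acting letter by letter, and each group
   acts on itself by conjugation. *)
Record compatible_actions (G H : groupType) := CompatibleActions {
  actl : G -> H -> G;
  actr : H -> G -> H;
  actlM : forall h, {morph actl^~ h : g1 g2 / g1 * g2};
  actl1 : forall g, actl g 1 = g;
  actlA : forall g h1 h2, actl g (h1 * h2) = actl (actl g h1) h2;
  actrM : forall g, {morph actr^~ g : h1 h2 / h1 * h2};
  actr1 : forall h, actr h 1 = h;
  actrA : forall h g1 g2, actr h (g1 * g2) = actr (actr h g1) g2;
  actl_compat : forall g h g1, actl g (actr h g1) = actl (g ^ g1^-1) h ^ g1;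
  actr_compat : forall h g h1, actr h (actl g h1) = actr (h ^ h1^-1) g ^ h1
}.

Section PeifferProduct.
Variables (G H : groupType) (A : compatible_actions G H).

Definition peiffer_relators : set (free_product G H) :=
  [set r | exists (g : G) (h : H),
     r = (fp_inr G h)^-1 * (fp_inl H g)^-1 * fp_inr G h * fp_inl H (actl A g h)
     \/
     r = (fp_inl H g)^-1 * (fp_inr G h)^-1 * fp_inl H g * fp_inr G (actr A h g)].

Definition peiffer_product : groupType :=
  quotient_group (normal_closure_normal peiffer_relators).

End PeifferProduct.

Fact conjg_compat (G : groupType) (x y z : G) :
  x ^ (y ^ z) = ((x ^ z^-1) ^ y) ^ z.
Proof. by rewrite -!conjgM /conjg mulgA. Qed.

Definition conj_actions (G : groupType) : compatible_actions G G :=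
  CompatibleActions
    (fun z x y => conjMg x y z) (@conjg1 G) (@conjgM G)
    (fun z x y => conjMg x y z) (@conjg1 G) (@conjgM G)
    (@conjg_compat G) (@conjg_compat G).

Definition peiffer_square (G : groupType) : groupType :=
  peiffer_product (conj_actions G).

(* Main.v *)
Require Import Defs.
From mathcomp Require Import all_boot all_algebra.
From mathcomp Require Import boolp classical_sets.
From mathcomp Require Import fraction zify.

Set Implicit Arguments.
Unset Strict Implicit.
Unset Printing Implicit Defensive.

Import GRing.Theory.

Local Open Scope classical_set_scope.
Local Open Scope group_scope.

(** Write [L] and [R] for the two embeddings of [G] in the Peiffer square. The
relators make each copy act on the other by conjugation, so both copies are
normal and every element has the form [L x * R y] ([pe_normal_form]). The
commutator of [L a] and [R b] can be computed in either copy, as [L [~ a, b]]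
and as [R [~ a, b]]; hence [L] and [R] agree on the derived subgroup
([pe_square_derived]).

Two homomorphisms leave the Peiffer square: the fold map to [G], which is the
identity on both copies, and the projection to the abelianization [G^ab] which
kills the right copy. If both are trivial on [L x * R y], then [x * y = 1] and
[x] lies in the derived subgroup, so [L x * R y = R x * R x^-1 = 1]. Thus the
Peiffer square embeds in the product of [G] and [G^ab], and it suffices to
represent [G] and [G^ab] faithfully over one field and take the direct sum.

In both cases of the hypothesis [G^ab] is finitely generated: it inherits the
generators of [G], or it is trivial ([abelianization_fg]). A finitely generated
abelian group is linear over an extension of any given field ([fg_abelian_rep]).
This goes by adding one generator [a] at a time to a subgroup [B]. If a positive
power of [a] lies in [B], then [B] has finite index there and the induced
representation works ([adjoin_finite_rep]). Otherwise the new subgroup is the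
direct product of [B] and an infinite cyclic group, and the latter is faithfully
represented by the powers of a new indeterminate ([adjoin_infinite_rep]); this
is the only place where the field grows. *)

(** * Subgroups and homomorphisms *)

Section Subgroups.
Variables (G : groupType) (S : set G).
Hypothesis sS : is_subgroup S.

Lemma subg1 : S 1. Proof. by case: sS. Qed.

Lemma subgF x y : S x -> S y -> S (x / y). Proof. by case: sS => _; apply. Qed.

Lemma subgV x : S x -> S x^-1.
Proof. by move=> Sx; rewrite -[x^-1]mul1g; apply: subgF => //; apply: subg1. Qed.

Lemma subgM x y : S x -> S y -> S (x * y).
Proof. by move=> Sx Sy; rewrite -[y]invgK; apply: subgF => //; apply: subgV. Qed.

Lemma subgX x n : S x -> S (x ^+ n).
Proof.
by move=> Sx; elim: n => [|n IHn]; [apply: subg1 | rewrite expgS; apply: subgM].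
Qed.

End Subgroups.

Lemma generated_subgroup (G : groupType) (A : set G) :
  is_subgroup (generated A).
Proof.
split=> [|x y Ax Ay] S SA; first by case: SA => [[]].
by case: (SA) => [[_ SF] _]; apply: SF; [apply: Ax | apply: Ay].
Qed.

Lemma morphism1 (G H : groupType) (h : G -> H) :
  {morph h : x y / x * y} -> h 1 = 1.
Proof. by move=> hM; apply: (mulgI (h 1)); rewrite -hM !mulg1. Qed.

Lemma morphismV (G H : groupType) (h : G -> H) :
  {morph h : x y / x * y} -> {morph h : x / x^-1}.
Proof.
by move=> hM x; apply: (mulgI (h x)); rewrite -hM !mulgV; apply: morphism1.
Qed.

Lemma preimage_subgroup (G H : groupType) (h : G -> H) (S : set H) :
  {morph h : x y / x * y} -> is_subgroup S -> is_subgroup (h @^-1` S).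
Proof.
move=> hM sS; split=> [|x y Sx Sy]; rewrite /preimage /=.
  by rewrite morphism1 //; apply: subg1.
by rewrite hM morphismV //; apply: subgF.
Qed.

(** * Matrix representations *)

Section MatrixRepresentations.
Local Open Scope ring_scope.

(** Rows and columns are indexed by an arbitrary finite type, so that direct sums
and induced representations are indexed by sums and products of types; and only
the subgroup [C] is represented, so that a tower of subgroups of one group needs
no change of type. *)
Record matrix_rep (G : groupType) (C : set G) (F : fieldType) (I : finType)
    (r : G -> I -> I -> F) : Prop := MatrixRep {
  rep1 : forall i j, r 1%g i j = (i == j)%:R;
  repM : forall x y, C x -> C y ->
    forall i j, r (x * y)%g i j = \sum_k r x i k * r y k j }.

Definition rep_ker (G : groupType) (F : fieldType) (I : finType)
    (r : G -> I -> I -> F) : set G :=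
  [set x | forall i j, r x i j = (i == j)%:R].

Definition faithful_on (G : groupType) (C : set G) (F : fieldType)
    (I : finType) (r : G -> I -> I -> F) : Prop :=
  forall x, C x -> rep_ker r x -> x = 1%g.

Lemma linear_group_of_rep (G : groupType) (F : fieldType) (I : finType)
    (i0 : I) (r : G -> I -> I -> F) :
  matrix_rep setT r -> faithful_on setT r -> linear_group G.
Proof.
move=> rP r_inj.
pose f x : 'M[F]_#|I| := \matrix_(i, j) r x (enum_val i) (enum_val j).
have f1 : f 1%g = 1%:M.
  by apply/matrixP=> i j; rewrite !mxE (rep1 rP) (inj_eq enum_val_inj).
have fM x y : f (x * y)%g = f x *m f y.
  apply/matrixP=> i j; rewrite !mxE (repM rP) //.
  rewrite (reindex_onto (@enum_val I predT) enum_rank) /=.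
    by apply: eq_big => [k | k _]; rewrite ?mxE ?enum_valK ?eqxx.
  by move=> k _; rewrite enum_rankK.
exists #|I|, F, f; split=> //.
- by apply/card_gt0P; exists i0.
- move=> x; suff /mulmx1_unit[]: f x *m f x^-1%g = 1%:M by [].
  by rewrite -fM mulgV.
- move=> x y fxy; apply: divg1_eq; apply: r_inj => // i j.
  have: f (x / y)%g = 1%:M by rewrite fM fxy -fM mulgV.
  by move/matrixP/(_ (enum_rank i) (enum_rank j)); rewrite !mxE !enum_rankK
    (inj_eq enum_rank_inj).
Qed.

Lemma rep_of_linear_group (G : groupType) : linear_group G ->
  exists (F : fieldType) (I : finType) (i0 : I) (r : G -> I -> I -> F),
    matrix_rep setT r /\ faithful_on setT r.
Proof.
move=> [n [F [f [n_gt0 f_unit fM f_inj]]]].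
have f1 : f 1%g = 1%:M.
  apply: (can_inj (mulmxK (f_unit 1%g))).
  by rewrite -fM mulg1 mul1mx.
exists F, 'I_n, (Ordinal n_gt0), (fun x i j => f x i j); split.
  by split=> [i j | x y _ _ i j]; rewrite ?f1 ?fM mxE.
move=> x _ fx; apply: f_inj; rewrite f1; apply/matrixP=> i j.
by rewrite fx mxE.
Qed.

Lemma rep_map (G : groupType) (C : set G) (F K : fieldType)
    (u : {rmorphism F -> K}) (I : finType) (r : G -> I -> I -> F) :
  matrix_rep C r -> matrix_rep C (fun x i j => u (r x i j)).
Proof.
move=> rP; split=> [i j | x y Cx Cy i j]; first by rewrite (rep1 rP) rmorph_nat.
by rewrite (repM rP) // rmorph_sum; apply: eq_bigr => k _; rewrite rmorphM.
Qed.

Lemma faithful_map (G : groupType) (C : set G) (F K : fieldType)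
    (u : {rmorphism F -> K}) (I : finType) (r : G -> I -> I -> F) :
  faithful_on C r -> faithful_on C (fun x i j => u (r x i j)).
Proof.
move=> r_inj x Cx rx; apply: r_inj => // i j; apply: (fmorph_inj u).
by rewrite rx rmorph_nat.
Qed.

Lemma rep_pullback (G H : groupType) (C : set G) (D : set H) (h : G -> H)
    (F : fieldType) (I : finType) (r : H -> I -> I -> F) :
  h 1%g = 1%g -> (forall x, C x -> D (h x)) ->
  (forall x y, C x -> C y -> h (x * y)%g = (h x * h y)%g) ->
  matrix_rep D r -> matrix_rep C (fun x => r (h x)).
Proof.
move=> h1 hCD hM rP; split=> [i j | x y Cx Cy i j].
  by rewrite h1 (rep1 rP).
by rewrite hM // (repM rP) //; apply: hCD.
Qed.

Section DirectSum.
Variables (G : groupType) (C : set G) (F : fieldType) (I J : finType).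
Variables (r : G -> I -> I -> F) (s : G -> J -> J -> F).

Definition rep_sum (x : G) (i j : I + J) : F :=
  match i, j with
  | inl i', inl j' => r x i' j'
  | inr i', inr j' => s x i' j'
  | _, _ => 0
  end.

Lemma rep_sumP : matrix_rep C r -> matrix_rep C s -> matrix_rep C rep_sum.
Proof.
move=> rP sP; split=> [[i|i] [j|j] | x y Cx Cy [i|i] [j|j]] //=.
- by rewrite (rep1 rP).
- by rewrite (rep1 sP).
- rewrite (repM rP) // big_sumType /= [X in _ + X]big1 ?addr0 // => k _.
  by rewrite mul0r.
- rewrite big_sumType /= [X in X + _]big1 => [|k _]; last by rewrite mulr0.
  by rewrite [X in _ + X]big1 ?addr0 // => k _; rewrite mul0r.
- rewrite big_sumType /= [X in X + _]big1 => [|k _]; last by rewrite mul0r.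
  by rewrite [X in _ + X]big1 ?addr0 // => k _; rewrite mulr0.
- rewrite (repM sP) // big_sumType /= [X in X + _]big1 ?add0r // => k _.
  by rewrite mul0r.
Qed.

Lemma rep_sum_ker : rep_ker rep_sum `<=` rep_ker r `&` rep_ker s.
Proof.
move=> x rsx; split=> i j; first by have := rsx (inl i) (inl j).
by have := rsx (inr i) (inr j).
Qed.

End DirectSum.

Section Induced.
Variables (G : groupType) (B C : set G) (F : fieldType) (I T : finType).
Variables (r : G -> I -> I -> F) (t : T -> G).
Hypotheses (sB : is_subgroup B) (rP : matrix_rep B r).
(* Right multiplication by an element of [C] permutes the cosets of [B] that
   [t] represents. *)
Hypothesis t_cover : forall i x, C x -> exists k, B (t i * x / t k)%g.
Hypothesis t_inj : forall i j, B (t i / t j)%g -> i = j.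

(** The representation induced from [B]: in block form, block [(i, j)] is
[r (t i * x / t j)], or 0 when that element is outside [B]. *)
Definition rep_induced (x : G) (i j : T * I) : F :=
  if `[< B (t i.1 * x / t j.1)%g >] then r (t i.1 * x / t j.1)%g i.2 j.2 else 0.

Lemma rep_inducedP : matrix_rep C rep_induced.
Proof.
split=> [[i p] [j q] | x y Cx Cy [i p] [j q]]; rewrite /rep_induced /=.
  rewrite mulg1 -pair_eqE /pair_eq /=; have [<-|neq_ij] := eqVneq i j.
    by rewrite mulgV asboolT ?(rep1 rP) //; apply: subg1.
  by rewrite asboolF // => /t_inj eq_ij; rewrite eq_ij eqxx in neq_ij.
(* In block row [i] of the matrix of [x] only the block [k0] is nonzero. *)
have [k0 Bk0] := t_cover i Cx.
rewrite -(pair_bigA _ (fun k l =>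
  (if `[< B (t i * x / t k)%g >] then r (t i * x / t k)%g p l else 0) *
  (if `[< B (t k * y / t j)%g >] then r (t k * y / t j)%g l q else 0))) /=.
rewrite (bigD1 k0) //= [X in _ + X]big1 => [|k neq_k]; last first.
  apply: big1 => l _; case: asboolP => [Bk|]; last by rewrite mul0r.
  case/eqP: neq_k; apply: t_inj.
  have -> : (t k / t k0 = (t i * x / t k)^-1 * (t i * x / t k0))%g.
    by rewrite invgF divgKA.
  exact: subgM (subgV _ _) _.
have xyE : (t i * (x * y) / t j = (t i * x / t k0) * (t k0 * y / t j))%g.
  by rewrite -[(t k0 * y / _)%g]mulgA divgKA !mulgA.
rewrite addr0 (asboolT Bk0); case: asboolP => [Bxy | nBxy]; last first.
  rewrite asboolF => [|By]; first by rewrite big1 // => l _; rewrite mulr0.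
  by apply: nBxy; rewrite xyE; apply: subgM.
have By : B (t k0 * y / t j)%g.
  rewrite -[X in B X](mulKg (t i * x / t k0)%g) -xyE.
  exact: subgM (subgV _ _) _.
by rewrite (asboolT By) xyE (repM rP).
Qed.

(** The identity matrix has nonzero diagonal blocks, so an element [x] of the
kernel has [t i0 * x / t i0] in [B], and this conjugate lies in the kernel of
[r]. *)
Lemma rep_induced_faithful (p0 : I) (i0 : T) :
  faithful_on B r -> faithful_on C rep_induced.
Proof.
move=> r_inj x Cx rx.
have Bx : B (t i0 * x / t i0)%g.
  apply/asboolP; have := rx (i0, p0) (i0, p0); rewrite /rep_induced eqxx.
  by case: asboolP => //= _ /esym/eqP; rewrite oner_eq0.
have/(congr1 (fun z => z * t i0)%g) : (t i0 * x / t i0 = 1)%g.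
  apply: r_inj => // p q; have := rx (i0, p) (i0, q).
  by rewrite /rep_induced asboolT //= -pair_eqE /pair_eq /= eqxx.
by rewrite mulgVK mul1g -[RHS]mulg1 => /mulgI.
Qed.

End Induced.

End MatrixRepresentations.

(** * Adjoining one element to a subgroup of an abelian group *)

Section CyclicExtension.
Variables (A : groupType) (mulC : forall x y : A, x * y = y * x).
Variables (B : set A) (sB : is_subgroup B) (a : A).

Lemma mulgACA (x y u v : A) : (x * y) * (u * v) = (x * u) * (y * v).
Proof. by rewrite -!mulgA; congr (_ * _); rewrite !mulgA [y * u]mulC. Qed.

Lemma mulFACA (x y u v : A) : (x / y) * (u / v) = (x * u) / (y * v).
Proof.
by rewrite invgM -!mulgA; congr (_ * _); rewrite [LHS]mulC -mulgA.
Qed.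

Lemma expF_eq m n p q : m + q = n + p -> a ^+ m / a ^+ p = a ^+ n / a ^+ q.
Proof.
move=> e; apply: divg1_eq; rewrite invgF mulFACA -!expgnDr [(p + n)%N]addnC e.
by rewrite mulgV.
Qed.

(** The natural exponents [p] and [q] encode the integer exponent [p - q] of [a];
as [A] is abelian, the products of elements of [B] by powers of [a] already form
the subgroup generated by [B] and [a]. *)
Definition adjoin : set A :=
  [set x | exists p q, B (x * a ^+ q / a ^+ p)].

Lemma adjoin_subgroup : is_subgroup adjoin.
Proof.
split=> [|x y [p [q Bx]] [p' [q' By]]].
  by exists 0, 0; rewrite !expg0 !mulg1 divg1; apply: subg1.
exists (p + q'), (q + p'); have := subgF sB Bx By.
have -> : (x / y) * a ^+ (q + p') / a ^+ (p + q')
          = (x / y) * (a ^+ (q + p') / a ^+ (p + q')) by rewrite mulgA.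
by rewrite invgF !mulFACA !expgnDr !mulgA [y * _]mulC.
Qed.

(** Serves both for [a] of infinite order modulo [B] and, thanks to the bound on
[n], for the powers of [a] below a finite order. *)
Lemma expF_mem_inj i j :
  (forall n, 0 < n <= maxn i j -> ~ B (a ^+ n)) -> B (a ^+ i / a ^+ j) -> i = j.
Proof.
move=> nB; case: (ltngtP i j) => // lt_ij Bij; exfalso.
  apply: (nB (j - i)); first by rewrite subn_gt0 lt_ij leq_max leq_subr orbT.
  by rewrite expgnFr 1?ltnW // -invgF; apply: subgV.
apply: (nB (i - j)); first by rewrite subn_gt0 lt_ij leq_max leq_subr.
by rewrite expgnFr 1?ltnW.
Qed.

(** A negative exponent of [a] becomes nonnegative, modulo [B], on adding a
multiple of [m]. *)
Lemma adjoin_coset m x :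
  0 < m -> B (a ^+ m) -> adjoin x -> exists k : 'I_m, B (x / a ^+ k).
Proof.
move=> m_gt0 Bm [p [q Bx]].
(* [n] is a natural number congruent to [p - q] modulo [m]. *)
pose n := p + m.-1 * q.
exists (Ordinal (ltn_pmod n m_gt0)) => /=.
have Bn : B (x / a ^+ n).
  have -> : x / a ^+ n = (x * a ^+ q / a ^+ p) / a ^+ (m * q).
    rewrite -[RHS]mulgA -invgM -expgnDr -mulgA; congr (_ * _).
    rewrite -[LHS]mul1g -(expg0 a); apply: expF_eq.
    by rewrite /n -{1}(prednK m_gt0) mulSn; lia.
  by apply: subgF => //; rewrite expgnA; apply: subgX.
have -> : x / a ^+ (n %% m) = (x / a ^+ n) * a ^+ (m * (n %/ m)).
  rewrite -mulgA; congr (_ * _); rewrite -[LHS]mul1g -(expg0 a) [RHS]mulC.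
  by apply: expF_eq; rewrite mulnC -divn_eq.
by apply: subgM => //; rewrite expgnA; apply: subgX.
Qed.

Variables (F : fieldType) (I : finType) (i0 : I) (r : A -> I -> I -> F).
Hypotheses (rP : matrix_rep B r) (r_inj : faithful_on B r).

(** Here [m] is the order of [a] modulo [B], and the powers of [a] below [m] form
a transversal from which [r] is induced. *)
Lemma adjoin_finite_rep m :
  0 < m -> B (a ^+ m) -> (forall n, 0 < n < m -> ~ B (a ^+ n)) ->
  exists (J : finType) (j0 : J) (s : A -> J -> J -> F),
    matrix_rep adjoin s /\ faithful_on adjoin s.
Proof.
move=> m_gt0 Bm m_min; pose t (k : 'I_m) := a ^+ k.
have t_cover i x : adjoin x -> exists k, B (t i * x / t k).
  move=> Cx; apply: adjoin_coset => //; case: Cx => [p [q Bx]].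
  exists (p + i), q.
  by rewrite /t -[a ^+ i * x * _]mulgA [a ^+ i * _]mulC expgnDr mulgKA.
have t_inj i j : B (t i / t j) -> i = j.
  move=> Bij; apply/val_inj/expF_mem_inj => //= n /andP[n_gt0 le_n].
  by apply: m_min; rewrite n_gt0 (leq_ltn_trans le_n) // gtn_max !ltn_ord.
exists ('I_m * I)%type, (Ordinal m_gt0, i0), (rep_induced B r t).
split; first exact: rep_inducedP.
exact: rep_induced_faithful (Ordinal m_gt0) _.
Qed.

(** The exponent of [a] in an element of [adjoin] is well defined, so the latter is
the direct product of [B] and the infinite cyclic group generated by [a].
Represent the first factor by [r] and the second by sending [a] to an
indeterminate. *)
Lemma adjoin_infinite_rep : (forall n, 0 < n -> ~ B (a ^+ n)) ->
  exists (K : fieldType) (u : {rmorphism F -> K}) (J : finType) (j0 : J)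
    (s : A -> J -> J -> K), matrix_rep adjoin s /\ faithful_on adjoin s.
Proof.
move=> nB.
pose K : fieldType := {fraction {poly F}}.
pose tf : {rmorphism {poly F} -> K} := @tofrac {poly F}.
pose u : {rmorphism F -> K} := tf \o polyC.
pose X : K := tf 'X%R.
have X0 : (X != 0)%R by rewrite tofrac_eq0 polyX_eq0.
have X_inj m n : (X ^+ m = X ^+ n)%R -> m = n.
  rewrite -!rmorphXn => /eqP; rewrite tofrac_eq => /eqP.
  by move/(congr1 (fun p => size (polyseq p))); rewrite !size_polyXn => -[].
(* [(e x).1 - (e x).2] is the exponent of [a] in [x], and [b x] below is the
   component of [x] in [B]. *)
have /choice[e eP] (x : A) : exists e : nat * nat,
    adjoin x -> B (x * a ^+ e.2 / a ^+ e.1).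
  have [[p [q Bx]]|nCx] := pselect (adjoin x); last by exists (0, 0).
  by exists (p, q).
have e_uniq x p q : adjoin x -> B (x * a ^+ q / a ^+ p) ->
    (e x).2 + p = q + (e x).1.
  move=> Cx Bx; apply: expF_mem_inj => [n /andP[n_gt0 _]|]; first exact: nB.
  have := subgF sB (eP x Cx) Bx.
  rewrite invgF mulFACA -[x * _ * _]mulgA [x * (_ * _)]mulC [x * _]mulC.
  by rewrite [a ^+ _ * (_ * x)]mulgA mulgKA -!expgnDr [(_ + q)%N]addnC.
pose b x := x * a ^+ (e x).2 / a ^+ (e x).1.
pose chi x (i j : unit) : K := (X ^+ (e x).1 / X ^+ (e x).2)%R.
have C1 : adjoin 1 by apply: subg1; apply: adjoin_subgroup.
have e1 : (e 1).2 = (e 1).1.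
  have := e_uniq 1 0 0 C1; rewrite addn0 add0n; apply.
  by rewrite !expg0 mulg1 divg1; apply: subg1.
have eM x y : adjoin x -> adjoin y ->
   (e (x * y)).2 + ((e x).1 + (e y).1) = ((e x).2 + (e y).2) + (e (x * y)).1.
  move=> Cx Cy; apply: e_uniq; first exact: (subgM adjoin_subgroup).
  have := subgM sB (eP x Cx) (eP y Cy).
  by rewrite mulFACA mulgACA -!expgnDr.
have chiP : matrix_rep adjoin chi.
  split=> [[] []|x y Cx Cy [] []]; first by rewrite /chi e1 divff ?expf_neq0.
  rewrite (bigD1 tt) //= big1 ?addr0; last by case.
  rewrite /chi mulf_div -!exprD; apply/eqP; rewrite eqr_div ?expf_neq0 //.
  by rewrite -!exprD; apply/eqP; congr (_ ^+ _)%R; have := eM x y Cx Cy; lia.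
have bP : matrix_rep adjoin (fun x => r (b x)).
  apply: rep_pullback rP => [|x Cx|x y Cx Cy].
  - by rewrite /b e1 mul1g mulgV.
  - exact: eP.
  - rewrite /b mulFACA mulgACA -!expgnDr -!mulgA; do 2!congr (_ * _).
    by apply: expF_eq; apply: eM.
exists K, u, (I + unit)%type, (inl i0).
exists (rep_sum (fun x i j => u (r (b x) i j)) chi).
split; first by apply: rep_sumP chiP; apply: rep_map.
move=> x Cx /rep_sum_ker[rx chix].
have bx1 : b x = 1 by apply: (faithful_map (u := u) r_inj) rx; apply: eP.
have ex : (e x).1 = (e x).2.
  apply: X_inj; have := chix tt tt.
  rewrite /chi => /(congr1 (fun z => z * X ^+ (e x).2)%R).
  by rewrite mul1r mulfVK // expf_neq0.
by move: bx1; rewrite /b ex mulgK.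
Qed.

End CyclicExtension.

(** [F] has to be extended because its nonzero elements may all be roots of unity;
each generator of infinite order modulo the previous ones is sent to a new
indeterminate. *)
Lemma fg_abelian_rep (A : groupType) (F : fieldType) (l : seq A) :
  (forall x y : A, x * y = y * x) ->
  exists (K : fieldType) (u : {rmorphism F -> K}) (I : finType) (i0 : I)
      (r : A -> I -> I -> K),
    matrix_rep (generated [set` l]) r /\ faithful_on (generated [set` l]) r.
Proof.
move=> mulC; elim: l => [|a l [K [u [I [i0 [r [rP r_inj]]]]]]].
  exists F, idfun, unit, tt, (fun _ _ _ => 1%R); split.
    split=> [[] []|x y _ _ [] []] //.
    by rewrite (bigD1 tt) //= big1 ?mul1r ?addr0 //; case.
  have s1 : is_subgroup [set 1 : A].
    by split=> // x y -> ->; rewrite mulgV.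
  by move=> x gx _; apply: (smallest_sub s1) gx.
set B := generated [set` l] in rP r_inj.
have sB : is_subgroup B := generated_subgroup _.
have gen_sub : generated [set` a :: l] `<=` adjoin B a.
  apply: smallest_sub; first exact: adjoin_subgroup.
  move=> x /=; rewrite inE => /orP[/eqP->|lx].
    by exists 1%N, 0; rewrite expg0 mulg1 expg1 mulgV; apply: subg1.
  by exists 0, 0; rewrite !expg0 mulg1 divg1; apply: sub_gen_smallest.
suff [K' [u' [J [j0 [s [sP s_inj]]]]]] : exists (K' : fieldType)
    (u' : {rmorphism K -> K'}) (J : finType) (j0 : J) (s : A -> J -> J -> K'),
    matrix_rep (adjoin B a) s /\ faithful_on (adjoin B a) s.
  exists K', (u' \o u), J, j0, s; split; last by move=> x /gen_sub; apply: s_inj.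
  split; first exact: (rep1 sP).
  by move=> x y /gen_sub ? /gen_sub ?; apply: (repM sP).
have [fin|inf] := pselect (exists n, (0 < n) && `[< B (a ^+ n) >]); last first.
  apply: (adjoin_infinite_rep mulC sB i0 rP r_inj) => n n_gt0 Bn.
  by apply: inf; exists n; rewrite n_gt0 asboolT.
have [m /andP[m_gt0 /asboolP Bm] m_min] := ex_minnP fin.
have [n /andP[n_gt0 lt_nm] Bn|J [j0 [s sP]]] :=
    adjoin_finite_rep mulC sB i0 rP r_inj m_gt0 Bm.
  by have := m_min n; rewrite n_gt0 asboolT // leqNgt lt_nm => /(_ isT).
by exists K, idfun, J, j0, s.
Qed.

(** * Quotients, free products and Peiffer products *)

Section Quotient.
Variables (G : groupType) (N : set G) (nN : is_normal_subgroup N).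

Definition quo (x : G) : quotient_group nN := (\pi_(quotient_group nN) x)%qT.

Lemma quoM : {morph quo : x y / x * y}.
Proof. by move=> x y; apply: esym; apply: quotient_piM. Qed.

Lemma quo_surj q : exists x, q = quo x.
Proof. by exists (repr q); rewrite /quo reprK. Qed.

Lemma quo_eq x y : quo x = quo y <-> N (x / y).
Proof.
split=> [/eqmodP/asboolP // | Nxy].
by apply/eqmodP/asboolP.
Qed.

Lemma quo_eq1 x : quo x = 1 <-> N x.
Proof. by have := quo_eq x 1; rewrite divg1. Qed.

Lemma quo_lift (H : groupType) (f : G -> H) :
  {morph f : x y / x * y} -> (forall x, N x -> f x = 1) ->
  exists g : quotient_group nN -> H,
    {morph g : x y / x * y} /\ forall x, g (quo x) = f x.
Proof.
move=> fM fN; pose g (q : quotient_group nN) := f (repr q).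
have gE x : g (quo x) = f x.
  have /quo_eq/fN : quo (repr (quo x)) = quo x by rewrite /quo reprK.
  by move/(congr1 (fun z => z * f x)); rewrite -fM mulgVK mul1g.
exists g; split=> // x y.
by have [[x' ->] [y' ->]] := (quo_surj x, quo_surj y); rewrite -quoM !gE.
Qed.

End Quotient.

Section FreeProductLift.
Variables (G H K : groupType) (f : G -> K) (g : H -> K).
Hypotheses (fM : {morph f : x y / x * y}) (gM : {morph g : x y / x * y}).

Definition letter_val (c : G + H) : K :=
  match c with inl x => f x | inr y => g y end.

Definition word_val (w : seq (G + H)) : K :=
  foldr (fun c z => letter_val c * z) 1 w.

Lemma word_val_cat v w : word_val (v ++ w) = word_val v * word_val w.
Proof. by elim: v => [|c v IHv] /=; rewrite ?mul1g // IHv mulgA. Qed.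

Lemma word_val_eq v w : word_eq v w -> word_val v = word_val w.
Proof.
have [f1 g1] := (morphism1 fM, morphism1 gM).
elim=> //= [v1 v2 v3 _ -> _ -> //|v1 v2 v3 v4 _ e _ e'|||x y|x y].
- by rewrite !word_val_cat e e'.
- by rewrite f1 mulg1.
- by rewrite g1 mulg1.
- by rewrite fM !mulg1.
- by rewrite gM !mulg1.
Qed.

Lemma fp_lift : exists h : free_product G H -> K,
  [/\ {morph h : x y / x * y}, forall x, h (fp_inl H x) = f x
    & forall y, h (fp_inr G y) = g y].
Proof.
pose h (x : free_product G H) := word_val (repr x).
have hE w : h (\pi_(free_product G H) w)%qT = word_val w.
  apply/word_val_eq/asboolP; rewrite -[asbool _]/(word_equiv G H _ _).
  by apply/eqmodP; rewrite reprK.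
exists h; split=> [x y|x|y]; rewrite [LHS]hE /= ?mulg1 //.
exact: word_val_cat.
Qed.

End FreeProductLift.

Lemma fp_ind (G H : groupType) (P : free_product G H -> Prop) :
  P 1 -> (forall x z, P z -> P (fp_inl H x * z)) ->
  (forall y z, P z -> P (fp_inr G y * z)) -> forall z, P z.
Proof.
move=> P1 PL PR z; rewrite -[z]reprK; elim: (repr z) => [//|[x|y] w IHw].
  by have := PL x _ IHw; rewrite -[_ * _]/(fp_mul _ _) fp_piM.
by have := PR y _ IHw; rewrite -[_ * _]/(fp_mul _ _) fp_piM.
Qed.

Section PeifferProduct.
Variables (G H : groupType) (X : compatible_actions G H).

Definition pe_inl (x : G) : peiffer_product X := quo _ (fp_inl H x).
Definition pe_inr (y : H) : peiffer_product X := quo _ (fp_inr G y).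

Lemma pe_inlM : {morph pe_inl : x y / x * y}.
Proof.
move=> x y; rewrite -quoM; congr quo; rewrite -[RHS]/(fp_mul _ _) fp_piM.
by apply/esym/eqmodP/asboolP; apply: WordMulL.
Qed.

Lemma pe_inrM : {morph pe_inr : x y / x * y}.
Proof.
move=> x y; rewrite -quoM; congr quo; rewrite -[RHS]/(fp_mul _ _) fp_piM.
by apply/esym/eqmodP/asboolP; apply: WordMulR.
Qed.

Lemma pe_actl g h : pe_inl (actl X g h) = pe_inl g ^ pe_inr h.
Proof.
have : quo (normal_closure_normal (peiffer_relators X))
    ((fp_inr G h)^-1 * (fp_inl H g)^-1 * fp_inr G h * fp_inl H (actl X g h)) = 1.
  by apply/quo_eq1; apply: sub_gen_smallest; exists g, h; left.
rewrite !quoM !(morphismV (@quoM _ _ _)) -/(pe_inl _) -/(pe_inr _).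
by move/mulg1_eq; rewrite !invgM !invgK.
Qed.

Lemma pe_actr g h : pe_inr (actr X h g) = pe_inr h ^ pe_inl g.
Proof.
have : quo (normal_closure_normal (peiffer_relators X))
    ((fp_inl H g)^-1 * (fp_inr G h)^-1 * fp_inl H g * fp_inr G (actr X h g)) = 1.
  by apply/quo_eq1; apply: sub_gen_smallest; exists g, h; right.
rewrite !quoM !(morphismV (@quoM _ _ _)) -/(pe_inl _) -/(pe_inr _).
by move/mulg1_eq; rewrite !invgM !invgK.
Qed.

(** A letter of [H] moves to the right past a letter of [G] at the price of acting
on it. *)
Lemma pe_normal_form z : exists x y, z = pe_inl x * pe_inr y.
Proof.
have [w ->] := quo_surj z; move: w.
apply: fp_ind => [|g w [x [y IHw]]|h w [x [y IHw]]].
- exists 1, 1; rewrite (morphism1 pe_inlM) (morphism1 pe_inrM) mulg1.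
  exact/morphism1/quoM.
- by exists (g * x), y; rewrite quoM IHw mulgA pe_inlM.
- exists (actl X x h^-1), (h * y).
  rewrite quoM IHw pe_actl pe_inrM (morphismV pe_inrM) conjgE invgK.
  by rewrite !mulgA mulgVK.
Qed.

(** The universal property of the Peiffer product, which provides the fold map
and the projection to the abelianization. *)
Lemma pe_lift (K : groupType) (f : G -> K) (g : H -> K) :
  {morph f : x y / x * y} -> {morph g : x y / x * y} ->
  (forall x y, f (actl X x y) = f x ^ g y) ->
  (forall x y, g (actr X y x) = g y ^ f x) ->
  exists h : peiffer_product X -> K,
    [/\ {morph h : x y / x * y}, forall x, h (pe_inl x) = f x
      & forall y, h (pe_inr y) = g y].
Proof.
move=> fM gM f_act g_act; have [k [kM kl kr]] := fp_lift fM gM.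
have [|h [hM hE]] := quo_lift (normal_closure_normal (peiffer_relators X)) kM.
  have sk : is_normal_subgroup (k @^-1` [set 1]).
    split=> [|x y]; last rewrite /preimage /=.
      by apply: preimage_subgroup => //; split=> // x y -> ->; rewrite mulgV.
    by move=> kx; rewrite !kM kx mul1g -kM mulVg; apply: morphism1.
  move=> x; apply: (smallest_sub sk) => _ [a [b [->|->]]]; rewrite /preimage /=.
    rewrite !kM !(morphismV kM) !kl !kr f_act /conjg -!mulgA.
    by rewrite mulVKg mulKg mulVg.
  rewrite !kM !(morphismV kM) !kl !kr g_act /conjg -!mulgA.
  by rewrite mulVKg mulKg mulVg.
by exists h; split=> // x; rewrite hE.
Qed.

End PeifferProduct.

(** * The Peiffer square and the abelianization *)

Section Abelianization.
Variable G : groupType.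

Lemma commg_derived (x y : G) : derived_subgroup G [~ x, y].
Proof. by apply: sub_gen_smallest; exists x, y. Qed.

Lemma derived_normal : is_normal_subgroup (derived_subgroup G).
Proof.
split; first exact: generated_subgroup.
move=> x y dx; rewrite -[x ^ y](mulVKg x) -commgEl.
exact: (subgM (generated_subgroup _)) (commg_derived _ _).
Qed.

Definition abelianization : groupType := quotient_group derived_normal.

Lemma abelianizationC (x y : abelianization) : x * y = y * x.
Proof.
have [[a ->] [b ->]] := (quo_surj x, quo_surj y).
apply/commgP/eqP.
have /(quo_eq1 derived_normal) := commg_derived a b.
by rewrite commgEl conjgE !quoM !(morphismV (@quoM _ _ derived_normal)).
Qed.

Lemma abelianization_fg :
  finitely_generated G \/ derived_subgroup G = setT ->
  finitely_generated abelianization.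
Proof.
case=> [[l lG]|dG].
  exists (map (quo derived_normal) l); apply/seteqP; split=> // y _.
  have [x ->] := quo_surj y; have: generated [set` l] x by rewrite lG.
  apply: (@smallest_sub _ _ _ (quo derived_normal @^-1` generated _)).
    by apply: preimage_subgroup (generated_subgroup _); apply: quoM.
  by move=> {}x /= lx; apply: sub_gen_smallest; apply: map_f.
exists [::]; apply/seteqP; split=> // y _; have [x ->] := quo_surj y.
have -> : quo derived_normal x = 1 by apply/quo_eq1; rewrite dG.
exact: subg1 (generated_subgroup _).
Qed.

(** Since each copy acts on the other by conjugation, [[~ L a, R b]] equals
[(L a)^-1 * L (a ^ b)] and also [R (b^-1 ^ a) * R b], that is, the image of
[[~ a, b]] under either embedding. *)
Lemma pe_square_derived (x : G) : derived_subgroup G x ->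
  pe_inl (conj_actions G) x = pe_inr (conj_actions G) x.
Proof.
set L := pe_inl _; set R := pe_inr _.
have LM : {morph L : x y / x * y} := @pe_inlM _ _ _.
have RM : {morph R : x y / x * y} := @pe_inrM _ _ _.
apply: (@smallest_sub _ _ _ [set x | L x = R x]) => [|_ [a [b ->]] /=].
  split=> [|a b /= La Lb]; first by rewrite /= !morphism1.
  by rewrite LM RM !(morphismV LM, morphismV RM) La Lb.
have -> : L [~ a, b] = [~ L a, R b].
  by rewrite commgEl LM (morphismV LM) [L (a ^ b)]pe_actl.
by rewrite [in RHS]commgEr RM [R (_ ^ a)]pe_actr -/R (morphismV RM) -commgEr.
Qed.

End Abelianization.

Theorem proposition5p1 (G : groupType) :
  linear_group G ->
  finitely_generated G \/ derived_subgroup G = [set: G]%classic ->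
  linear_group (peiffer_square G).
Proof.
move=> /rep_of_linear_group[F [I [i0 [r [rP r_inj]]]]] /abelianization_fg[l lG].
have [K [u [J [j0 [s [sP s_inj]]]]]] := fg_abelian_rep F l (@abelianizationC G).
rewrite {}lG in sP s_inj.
have [//|//|//|//|fold [foldM foldL foldR]] :=
  @pe_lift _ _ (conj_actions G) G id id.
pose q := quo (derived_normal G).
have qM : {morph q : x y / x * y} := @quoM _ _ _.
have [//|x y||x y|p [pM pL pR]] :=
  @pe_lift _ _ (conj_actions G) (abelianization G) q (fun=> 1).
- by rewrite mulg1.
- move=> x y; rewrite conjg1 /= /conjg !qM (morphismV qM).
  by rewrite [LHS]abelianizationC mulgK.
- by rewrite conj1g.
apply: (@linear_group_of_rep _ _ _ (inl i0 : (I + J)%type)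
  (rep_sum (fun x i j => u (r (fold x) i j)) (fun x => s (p x)))).
  apply: rep_sumP; first apply: rep_map.
    by apply: rep_pullback rP; [exact: morphism1 | | ].
  by apply: rep_pullback sP; [exact: morphism1 | | ].
move=> z _ /rep_sum_ker[rz sz].
have fold_z : fold z = 1 by apply: (faithful_map (u := u) r_inj).
have p_z : p z = 1 by apply: s_inj.
have [x [y zE]] := pe_normal_form z.
move: fold_z p_z; rewrite zE foldM pM foldL foldR pL pR mulg1.
move=> /mulg1_eq <- /quo_eq1/pe_square_derived ->.
by rewrite -pe_inrM mulgV; apply/morphism1/pe_inrM.
Qed.
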